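(* Let $\mathbb{K}\in\{\mathbb{R},\mathbb{C}\}$, let $S\subseteq\mathbb{K}$ be a finite set, and let $f\in\mathbb{K}[x_1,\dots,x_n]$ be a homogeneous polynomial of degree $d$. Run the following randomized algorithm on $f$: pick $R\in M_n(\mathbb{K})$ whose entries $r_{ij}$ are chosen uniformly and independently at random from $S$, set $h(x)=f(Rx)$, and compute the slices $T_{\bar 1},T_{\bar 2},T_{\bar 3}$ of $h$. If $T_{\bar 1}$ is singular, reject. Otherwise compute $T_{\bar 1}'=T_{\bar 1}^{-1}$ and accept if and only if $T_{\bar 1}'T_{\bar 2}$ and $T_{\bar 1}'T_{\bar 3}$ commute and $T_{\bar 1}'T_{\bar 2}$ is diagonalisable over $\mathbb{K}$. Then: (i) if $f$ is not equivalent to any polynomial in $\mathcal{P}_d$, the algorithm rejects $f$ with probability at least $1-\frac{2(d-2)}{|S|}$; (ii) if $f$ is equivalent to some polynomial in $\mathcal{P}_d$, the algorithm accepts $f$ with probability at least $1-\frac{n(d-1)}{|S|}$.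
   Context: A homogeneous polynomial $g$ of degree $d$ in $n$ variables corresponds to the unique symmetric tensor $(T_{i_1\dots i_d})$ of order $d$ with $g=\sum_{i_1,\dots,i_d\in[n]}T_{i_1\dots i_d}x_{i_1}\cdots x_{i_d}$. For $i_1,\dots,i_{d-2}\in[n]$, the slice $T_{i_1\dots i_{d-2}}$ is the symmetric $n\times n$ matrix with entries $(T_{i_1\dots i_{d-2}})_{i_{d-1},i_d}=T_{i_1\dots i_d}$. We write $T_{\bar k}$ for the slice $T_{k k\dots k}$ (all $d-2$ indices equal to $k$). $\mathcal{P}_d$ denotes the set of polynomials $\sum_{i=1}^n\alpha_ix_i^d$ with $\alpha_i\in\mathbb{K}$, $\alpha_i\neq0$ for all $i$. A polynomial $f$ is equivalent to $g$ if $f(x)=g(Ax)$ for some invertible $A\in M_n(\mathbb{K})$. *)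

(* Defs.v *)
From HB Require Import structures.
From mathcomp Require Import all_boot all_order all_algebra all_fingroup.
From mathcomp Require Import finmap boolp reals complex mpoly.

Set Implicit Arguments.
Unset Strict Implicit.
Unset Printing Implicit Defensive.

Import GRing.Theory Num.Theory.
Local Open Scope ring_scope.

Variant real_or_complex (R : realType) : numFieldType -> Prop :=
| RealScalars : real_or_complex R R
| ComplexScalars : real_or_complex R R[i].

Definition tensor (K : Type) (n d : nat) := d.-tuple 'I_n -> K.

Definition symmetric_tensor (K : Type) (n d : nat) (T : tensor K n d) : Prop :=
  forall (s : 'S_d) (t : d.-tuple 'I_n), T [tuple tnth t (s i) | i < d] = T t.

Definition tensor_poly (K : numFieldType) (n d : nat) (T : tensor K n d) :
    {mpoly K[n]} :=
  \sum_(t : d.-tuple 'I_n) T t *: \prod_(i < d) 'X_(tnth t i).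

Definition index_mnm (n d : nat) (t : d.-tuple 'I_n) : 'X_{1..n} :=
  (\sum_(i < d) U_(tnth t i))%MM.

(* Each coefficient of g is spread evenly over the index tuples that produce
   its monomial; lemma sym_tensorP below shows that this is the unique
   symmetric tensor representing a homogeneous g of degree d. *)
Definition sym_tensor (K : numFieldType) (n d : nat) (g : {mpoly K[n]}) :
    tensor K n d :=
  fun t => g@_(index_mnm t)
           / #|[set u : d.-tuple 'I_n | index_mnm u == index_mnm t]|%:R.

(* For d >= 2 the sequence u ++ [:: i; j] has length d, so the default value
   of nth is never used. *)
Definition slice (K : Type) (n d : nat) (T : tensor K n d)
    (u : (d - 2).-tuple 'I_n) : 'M[K]_n :=
  \matrix_(i, j) T [tuple nth j (u ++ [:: i; j]) p | p < d].

Definition bar_slice (K : Type) (n d : nat) (T : tensor K n d) (k : 'I_n) :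
    'M[K]_n :=
  slice T [tuple of nseq (d - 2) k].

(* The polynomial g(Ax). *)
Definition lin_subst (K : numFieldType) (n : nat) (g : {mpoly K[n]})
    (A : 'M[K]_n) : {mpoly K[n]} :=
  g \mPo [tuple \sum_(j < n) A i j *: 'X_j | i < n].

Definition equivalent (K : numFieldType) (n : nat) (f g : {mpoly K[n]}) : Prop :=
  exists2 A : 'M[K]_n, A \in unitmx & f = lin_subst g A.

(* Membership in the class P_d. *)
Definition in_Pd (K : numFieldType) (n d : nat) (g : {mpoly K[n]}) : Prop :=
  exists2 a : 'I_n -> K, (forall i, a i != 0) &
    g = \sum_(i < n) a i *: 'X_i ^+ d.

(* One run of the algorithm on f with random choice M; true means accept.
   The indices 1, 2, 3 of the slices are the ordinals 0, 1, 2. *)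
Definition algorithm (K : numFieldType) (n d : nat) (hn : (2 < n)%N)
    (f : {mpoly K[n]}) (M : 'M[K]_n) : bool :=
  let T := @sym_tensor K n d (lin_subst f M) in
  let T1 := bar_slice T (Ordinal (ltnW (ltnW hn))) in
  let T2 := bar_slice T (Ordinal (ltnW hn)) in
  let T3 := bar_slice T (Ordinal hn) in
  if T1 \in unitmx then
    let T1' := invmx T1 in
    comm_mxb (T1' *m T2) (T1' *m T3) && `[< diagonalizable (T1' *m T2) >]
  else false.

(* Probability of E for an n x n matrix with independent entries, each uniform
   on S: every outcome has mass \prod_(i, j) 1 / |S|. *)
Definition prob_uniform_mx (R : realType) (K : numFieldType) (n : nat)
    (S : {fset K}) (E : pred 'M[K]_n) : R :=
  \sum_(M : 'M[S]_n | E (map_mx val M))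
    \prod_(i < n) \prod_(j < n) (#|` S|%:R)^-1.

Arguments algorithm {K n} d hn f M.
Arguments prob_uniform_mx R {K n} S E.

Lemma index_mnmE n d (t : d.-tuple 'I_n) k :
  index_mnm t k = count_mem k t.
Proof.
rewrite /index_mnm mnm_sumE.
under eq_bigr do rewrite mnm1E.
rewrite -sum1_count [RHS]big_mkcond big_tuple /=.
by apply: eq_bigr => i _; case: eqP.
Qed.

Lemma mdeg_index_mnm n d (t : d.-tuple 'I_n) : mdeg (index_mnm t) = d.
Proof.
rewrite /index_mnm mdeg_sum.
by under eq_bigr do rewrite mdeg1; rewrite sum1_card card_ord.
Qed.

Lemma index_mnm_perm n d (t u : d.-tuple 'I_n) :
  index_mnm t = index_mnm u -> exists s : 'S_d, t = [tuple tnth u (s i) | i < d].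
Proof.
move=> e; have /tuple_permP[s es] : perm_eq t u.
  by apply/allP => k _ /=; rewrite -!index_mnmE e.
by exists s; apply: val_inj.
Qed.

Lemma index_mnm_surj n d (m : 'X_{1..n}) :
  mdeg m = d -> exists t : d.-tuple 'I_n, index_mnm t = m.
Proof.
elim: d m => [|d IH] m md.
  exists [tuple]; move/eqP: md; rewrite mdeg_eq0 => /eqP ->.
  by rewrite /index_mnm big_ord0.
have [i mi] : exists i, m i != 0%N.
  apply/existsP; rewrite -negb_forall; apply/negP => /forallP m0.
  by move: md; rewrite mdegE big1 // => i _; apply/eqP.
have mE : (U_(i) + (m - U_(i)) = m)%MM by rewrite addmC submK // lep1mP.
have /IH [t tE] : mdeg (m - U_(i))%MM = d.
  by move: md; rewrite -{1}mE mdegD mdeg1 add1n => -[].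
exists [tuple of i :: t].
rewrite -mE -tE /index_mnm big_ord_recl /=; congr (_ + _)%MM.
by apply: eq_bigr => j _; rewrite tnthS.
Qed.

Lemma mcoeff_tensor_poly (K : numFieldType) n d (T : tensor K n d) m :
  (tensor_poly T)@_m = \sum_(t | index_mnm t == m) T t.
Proof.
rewrite /tensor_poly raddf_sum /= [RHS]big_mkcond; apply: eq_bigr => t _.
rewrite mcoeffZ mprodXE mcoeffX -/(index_mnm t).
by case: eqP; rewrite ?mulr1 ?mulr0.
Qed.

Lemma sym_tensorP (K : numFieldType) n d (g : {mpoly K[n]}) :
  g \is d.-homog ->
  [/\ symmetric_tensor (@sym_tensor K n d g),
      tensor_poly (@sym_tensor K n d g) = g &
      forall T : tensor K n d, symmetric_tensor T -> tensor_poly T = g ->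
        T = @sym_tensor K n d g].
Proof.
have card_nz (t : d.-tuple 'I_n) :
    #|[set u : d.-tuple 'I_n | index_mnm u == index_mnm t]|%:R != 0 :> K.
  by rewrite pnatr_eq0 -lt0n; apply/card_gt0P; exists t; rewrite inE.
move=> hg; split.
- move=> s t; rewrite /sym_tensor.
  suff -> : index_mnm [tuple tnth t (s i) | i < d] = index_mnm t by [].
  rewrite /index_mnm [RHS](reindex_inj (@perm_inj _ s)) /=.
  by apply: eq_bigr => i _; rewrite tnth_mktuple.
- apply/mpolyP => m; rewrite mcoeff_tensor_poly.
  have [md|md] := eqVneq (mdeg m) d; last first.
    rewrite (dhomog_nemf_coeff hg md) big1 // => t /eqP tm.
    by move: md; rewrite -tm mdeg_index_mnm eqxx.
  have [t0 e0] := index_mnm_surj md.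
  rewrite (eq_bigr (fun=> @sym_tensor K n d g t0)) => [|t /eqP tm]; last first.
    by rewrite /sym_tensor tm e0.
  rewrite sumr_const -mulr_natr -cardsE /sym_tensor -e0.
  exact: mulfVK.
- move=> T sT gE; apply/funext => t; rewrite /sym_tensor -gE mcoeff_tensor_poly.
  rewrite (eq_bigr (fun=> T t)) => [|u /eqP/index_mnm_perm[s ->]].
    rewrite sumr_const -cardsE -(mulr_natr (T t)); apply/esym.
    exact: mulfK (card_nz t) _.
  exact: sT.
Qed.

(* Main.v *)
Require Import Defs.
From HB Require Import structures.
From mathcomp Require Import all_boot all_order all_algebra all_fingroup.
From mathcomp Require Import finmap boolp reals complex mpoly.

Set Implicit Arguments.
Unset Strict Implicit.
Unset Printing Implicit Defensive.

Import GRing.Theory Num.Theory.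
Local Open Scope ring_scope.

(**
  Let H(v) be the matrix of the bilinear form obtained by filling d - 2 slots of
  the symmetric tensor of f with v.  If r_k is the k-th column of R, the slice
  of f(Rx) at k is R^T H(r_k) R.  Hence the algorithm accepts iff R and H(r_1)
  are invertible, Y(r_2) and Y(r_3) commute and Y(r_2) is diagonalisable, where
  Y(v) = H(r_1)^-1 H(v).

  (i) Fix r_1 with H(r_1) invertible.  If some Y(v), Y(w) do not commute, then
  an entry of [Y(r_2), Y(r_3)] is a nonzero polynomial of degree 2(d - 2), and
  Schwartz-Zippel applies.  If all the Y(v) commute, then the span W of the
  diagonalisable ones is simultaneously diagonalisable.  If some Y(v) lies
  outside W, a linear form vanishing on W yields a nonzero polynomial of degree
  d - 2 in r_2 that vanishes whenever Y(r_2) is diagonalisable.  Otherwise all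
  the Y(v) are diagonal in one basis; as they are self-adjoint for the form
  H(r_1), that basis can be chosen orthogonal for H(r_1), and then all the H(v)
  become diagonal under one congruence.  A symmetric tensor all of whose slices
  are diagonal is supported on the constant indices, so f is equivalent to a
  polynomial in P_d.

  (ii) If f(x) = g(Ax) with g in P_d, the algorithm accepts as soon as
  det R * prod_k (AR)_{k1}^(d-2), of degree n(d - 1), does not vanish.
*)

(** * Counting zeros of polynomial functions *)

Definition splice (I S : finType) (J : pred I) (x0 x : {ffun I -> S}) :
    {ffun I -> S} := [ffun i => if J i then x0 i else x i].

(* Exchanging the J-coordinates of two independent samples is an involution, so
   splicing does not change the distribution. *)
Lemma card_splice (I S : finType) (J : pred I) (E : pred {ffun I -> S})
    (m c : nat) :
  (forall x0, m * #|[pred x | E (splice J x0 x)]| <= c)%N ->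
  (m * #|E| <= c)%N.
Proof.
move=> hE; have [X0|X0] := posnP #|{ffun I -> S}|.
  suff -> : #|E| = 0%N by rewrite muln0.
  by apply/eqP; rewrite -leqn0 -X0 max_card.
suff cE : (\sum_(x0 : {ffun I -> S}) #|[pred x | E (splice J x0 x)]|
           = #|{ffun I -> S}| * #|E|)%N.
  rewrite -(leq_pmul2l X0) mulnCA -cE big_distrr /=.
  by rewrite -sum_nat_const; apply: leq_sum => x0 _.
under eq_bigr do rewrite -sum1_card big_mkcond /=.
rewrite pair_big /=.
pose sw (p : {ffun I -> S} * {ffun I -> S}) :=
  (splice J p.2 p.1, splice J p.1 p.2).
have swK : involutive sw.
  by case=> x y; congr (_, _); apply/ffunP => i; rewrite !ffunE /=; case: (J i).
rewrite (reindex_inj (inv_inj swK)) /=.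
rewrite (eq_bigr (fun p => (E p.2 : nat))); last first.
  move=> p _; rewrite inE (_ : splice J _ _ = p.2); last first.
        by apply/ffunP => i; rewrite !ffunE; case: (J i).
  by case: (E p.2).
rewrite -(pair_big xpredT xpredT (fun _ y => (E y : nat))) /= sum_nat_const.
by rewrite -(sum1_card E) [in RHS]big_mkcond.
Qed.

Lemma card_coord (I S : finType) (i : I) (Z : {set S}) :
  (#|S| * #|[pred x : {ffun I -> S} | x i \in Z]| = #|Z| * #|{ffun I -> S}|)%N.
Proof.
pose F (j : I) := if j == i then mem Z else mem S.
have -> : #|[pred x : {ffun I -> S} | x i \in Z]| = #|family F|.
  apply: eq_card => x; rewrite !inE; apply/idP/familyP => [xi j|/(_ i)].
    by rewrite /F; case: eqP => [->|].
  by rewrite /F eqxx.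
rewrite card_ffun card_family foldrE big_map big_enum /= (bigD1 i) //= {1}/F eqxx.
rewrite mulnCA; congr (_ * _)%N.
rewrite (eq_bigr (fun=> #|S|)) => [|j /negbTE ji]; last by rewrite /F ji.
rewrite prod_nat_const -expnS; congr (_ ^ _)%N.
rewrite [RHS](cardD1 i) inE add1n; congr _.+1.
by apply: eq_card => j; rewrite !inE andbT.
Qed.

(** A polynomial is seen through its values, as an unnormalised list of coefficients and exponent
    vectors. Repeated monomials are allowed, so [k] is only an upper bound on the degree, and
    closure under sums and products is list manipulation. *)
Definition polyfun (K : fieldType) (I : finType) (k : nat)
    (F : (I -> K) -> K) : Prop :=
  exists2 s : seq (K * {ffun I -> nat}),
    (forall t, t \in s -> \sum_i t.2 i <= k)%N &
    forall x, F x = \sum_(t <- s) t.1 * \prod_i x i ^+ t.2 i.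

Lemma polyfun_const (K : fieldType) (I : finType) (c : K) :
  polyfun (I := I) 0 (fun=> c).
Proof.
exists [:: (c, [ffun=> 0%N])] => [t|x]; last first.
  rewrite big_seq1 /= big1 ?mulr1 // => i _; rewrite ffunE.
  exact: expr0.
by rewrite inE => /eqP-> /=; rewrite big1 // => i _; rewrite ffunE.
Qed.

Lemma polyfun_coord (K : fieldType) (I : finType) (i : I) :
  polyfun (K := K) 1 (fun x => x i).
Proof.
exists [:: (1, [ffun j => (j == i : nat)])] => [t|x].
  rewrite inE => /eqP-> /=; rewrite (bigD1 i) //= ffunE eqxx big1 // => j.
  by rewrite ffunE => /negbTE->.
rewrite big_seq1 /= (bigD1 i) //= ffunE eqxx big1 => [|j /negbTE ji].
  by rewrite mulr1 mul1r expr1.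
by rewrite ffunE ji expr0.
Qed.

Lemma polyfunW (K : fieldType) (I : finType) (k l : nat) (F : (I -> K) -> K) :
  (k <= l)%N -> polyfun k F -> polyfun l F.
Proof. by move=> kl [s hs E]; exists s => // t /hs /leq_trans; apply. Qed.

Lemma eq_polyfun (K : fieldType) (I : finType) (k : nat)
    (F G : (I -> K) -> K) : F =1 G -> polyfun k F -> polyfun k G.
Proof. by move=> FG [s hs E]; exists s => // x; rewrite -FG. Qed.

Lemma polyfunD (K : fieldType) (I : finType) (k : nat) (F G : (I -> K) -> K) :
  polyfun k F -> polyfun k G -> polyfun k (fun x => F x + G x).
Proof.
move=> [s hs FE] [r hr GE]; exists (s ++ r) => [t|x].
  by rewrite mem_cat => /orP[/hs|/hr].
by rewrite FE GE big_cat.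
Qed.

Lemma polyfunM (K : fieldType) (I : finType) (k l : nat)
    (F G : (I -> K) -> K) :
  polyfun k F -> polyfun l G -> polyfun (k + l) (fun x => F x * G x).
Proof.
move=> [s hs FE] [r hr GE].
pose mulm (a b : K * {ffun I -> nat}) :=
  (a.1 * b.1, [ffun i => a.2 i + b.2 i]%N).
exists [seq mulm a b | a <- s, b <- r] => [t|x].
  case/allpairsP => -[a b] /= [/hs ha /hr hb ->] /=.
  under eq_bigr do rewrite ffunE.
  by rewrite big_split /= leq_add.
rewrite FE GE big_allpairs_dep mulr_suml; apply: eq_bigr => a _.
rewrite mulr_sumr; apply: eq_bigr => b _ /=.
rewrite mulrACA -big_split /=; congr (_ * _).
by apply: eq_bigr => i _; rewrite ffunE exprD.
Qed.

Lemma polyfunZ (K : fieldType) (I : finType) (k : nat) (c : K)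
    (F : (I -> K) -> K) : polyfun k F -> polyfun k (fun x => c * F x).
Proof.
by move=> hF; rewrite -[k]add0n; apply: polyfunM => //; apply: polyfun_const.
Qed.

Lemma polyfun_sum (K : fieldType) (I J : finType) (k : nat) (P : pred J)
    (F : J -> (I -> K) -> K) :
  (forall j, polyfun k (F j)) -> polyfun k (fun x => \sum_(j | P j) F j x).
Proof.
move=> hF; elim: (index_enum J) => [|j r IH].
  apply: (@eq_polyfun _ _ _ (fun=> 0)) => [x|]; first by rewrite big_nil.
  exact: polyfunW (polyfun_const _ _).
case Pj: (P j); last by apply: eq_polyfun IH => x; rewrite big_cons Pj.
by apply: eq_polyfun (polyfunD (hF j) IH) => x; rewrite big_cons Pj.
Qed.

Lemma polyfun_prod (K : fieldType) (I J : finType) (k : J -> nat)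
    (F : J -> (I -> K) -> K) :
  (forall j, polyfun (k j) (F j)) ->
  polyfun (\sum_j k j) (fun x => \prod_j F j x).
Proof.
move=> hF; elim: (index_enum J) => [|j r IH].
  rewrite big_nil; apply: eq_polyfun (polyfun_const _ 1) => x.
  by rewrite big_nil.
rewrite big_cons; apply: eq_polyfun (polyfunM (hF j) IH) => x.
by rewrite big_cons.
Qed.

(** Induction on the variables that may occur. If [F] has degree [j] in one variable, its leading
    coefficient has degree at most [k - j] in the others. Either that coefficient vanishes, or at
    most [j] values of the variable are roots. *)
Lemma schwartz_zippel (K : fieldType) (I S : finType) (v : S -> K) (k : nat)
    (F : (I -> K) -> K) (x1 : I -> K) :
  injective v -> polyfun k F -> F x1 != 0 ->
  (#|S| * #|[pred x : {ffun I -> S} | F (v \o x) == 0%R]|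
     <= k * #|{ffun I -> S}|)%N.
Proof.
move=> vI [s hs FE] Fx1.
pose vars := enum I; have hvars t i : t \in s -> i \notin vars -> t.2 i = 0%N.
  by rewrite mem_enum.
elim: vars k F s x1 hs FE Fx1 hvars => [|i r IH] k F s x1 hs FE Fx1 hvars.
  suff -> : #|[pred x : {ffun I -> S} | F (v \o x) == 0]| = 0%N by rewrite muln0.
  apply: eq_card0 => x; rewrite !inE; apply: contra_neqF Fx1 => /eqP <-.
  rewrite !FE; apply: eq_big_seq => t ts; congr (_ * _).
  by apply: eq_bigr => i _; rewrite hvars.
(* [P x] is [F] as a univariate polynomial in coordinate [i]; its coefficients depend only on the
   other coordinates of [x]. *)
pose P x : {poly K} :=
  \sum_(t <- s) (t.1 * \prod_(j | j != i) x j ^+ t.2 j) *: 'X^(t.2 i).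
have FP x : F x = (P x).[x i].
  rewrite FE horner_sum; apply: eq_bigr => t _.
  rewrite hornerZ hornerXn -mulrA; congr (_ * _).
  by rewrite (bigD1 i) //= mulrC.
pose drop_i (t : K * {ffun I -> nat}) : K * {ffun I -> nat} :=
  (t.1, [ffun l => if l == i then 0%N else t.2 l]).
have PE x j : (P x)`_j =
    \sum_(t <- [seq drop_i t | t : K * {ffun I -> nat} <- s & t.2 i == j])
      t.1 * \prod_i x i ^+ t.2 i.
  rewrite big_map big_filter [RHS]big_mkcond coef_sum; apply: eq_bigr => t _ /=.
  rewrite coefZ coefXn eq_sym; case: eqP => _; rewrite ?mulr0 // mulr1.
  congr (_ * _); rewrite [RHS](bigD1 i) //= ffunE eqxx expr0 mul1r.
  by apply: eq_bigr => l /negbTE li; rewrite ffunE li.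
have Psize x : (size (P x) <= k.+1)%N.
  apply/leq_sizeP => j kj; rewrite coef_sum big_seq big1 // => t /hs tk.
  rewrite coefZ coefXn gtn_eqF ?mulr0 //.
  by apply: leq_trans kj; rewrite ltnS (leq_trans _ tk) // (bigD1 i) //= leq_addr.
(* Terms of [s] may cancel, so the degree in coordinate [i] is read off the values: [j] will be the
   largest index whose coefficient is nonzero at some point. *)
have Pex : exists j, `[< exists x, (P x)`_j != 0 >].
  exists (size (P x1)).-1; apply/asboolP; exists x1.
  rewrite -/(lead_coef _) lead_coef_eq0; apply: contraNneq Fx1.
  by rewrite FP => ->; rewrite horner0.
have Pbd j : `[< exists x, (P x)`_j != 0 >] -> (j <= k)%N.
  case/asboolP => x; apply: contra_neqT; rewrite -ltnNge => kj.
  by rewrite nth_default // (leq_trans (Psize x)).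
case: (ex_maxnP Pex Pbd) => j /asboolP[x2 Px2] jmax.
have jk := Pbd _ (introT (asboolP _) (ex_intro _ x2 Px2)).
have szP x : (size (P x) <= j.+1)%N.
  apply/leq_sizeP => l jl; apply/eqP; apply: contraTT jl => Pl.
  by rewrite -leqNgt jmax //; apply/asboolP; exists x.
have Pv (x y : I -> K) : (forall l, l != i -> x l = y l) -> P x = P y.
  move=> xy; apply: eq_bigr => t _; congr (_ * _ *: _).
  by apply: eq_bigr => l li; rewrite xy.
pose E1 := [pred x : {ffun I -> S} | (P (v \o x))`_j == 0].
pose E2 := [pred x : {ffun I -> S} | (F (v \o x) == 0) && ((P (v \o x))`_j != 0)].
have h1 : (#|S| * #|E1| <= (k - j) * #|{ffun I -> S}|)%N.
  apply: (IH _ (fun x => (P x)`_j) _ x2 _ (PE^~ j)) => //.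
    move=> _ /mapP[t + ->] /=; rewrite mem_filter => /andP[/eqP tj /hs].
    rewrite [X in (X <= _)%N](bigD1 i) //= [in X in _ -> X](bigD1 i) //= tj.
    rewrite ffunE eqxx add0n leq_subRL //; apply: leq_trans.
    by rewrite leq_add2l; apply: leq_sum => l /negbTE li; rewrite ffunE li.
  move=> _ l /mapP[t + ->] /=; rewrite mem_filter => /andP[_ ts] lr.
  by rewrite ffunE; case: eqP => // /eqP li; rewrite hvars // inE negb_or li.
have h2 : (#|S| * #|E2| <= j * #|{ffun I -> S}|)%N.
  (* With every coordinate but [i] frozen, [P] is one fixed polynomial with at most [j] roots. *)
  apply: (card_splice (J := predC1 i)) => x0.
  set Z := [set z | root (P (v \o x0)) (v z)].
  have PZ x : P (v \o splice (predC1 i) x0 x) = P (v \o x0).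
    by apply: Pv => l li; rewrite /= ffunE /= li.
  have [P0|P0] := eqVneq ((P (v \o x0))`_j) 0.
    suff -> : #|[pred x | E2 (splice (predC1 i) x0 x)]| = 0%N by rewrite muln0.
    by apply: eq_card0 => x; rewrite !inE PZ P0 eqxx andbF.
  have Zj : (#|Z| <= j)%N.
    have nz : P (v \o x0) != 0 by apply: contraNneq P0 => ->; rewrite coef0.
    rewrite -ltnS (leq_trans _ (szP (v \o x0))) //.
    rewrite cardE -(size_map v); apply: max_poly_roots => //.
      by apply/allP => _ /mapP[z + ->]; rewrite mem_enum inE.
    by rewrite map_inj_uniq // enum_uniq.
  apply: leq_trans (leq_mul Zj (leqnn _)); rewrite -(card_coord i).
  rewrite leq_mul2l subset_leq_card ?orbT //; apply/subsetP => x.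
  rewrite !inE => /andP[+ _]; rewrite FP PZ.
  by rewrite /= ffunE /= eqxx.
rewrite -(subnK jk) mulnDl; apply: leq_trans (leq_add h1 h2).
rewrite -mulnDr leq_mul2l; apply/orP; right.
rewrite -cardUI; apply: leq_trans (leq_addr _ _); apply: subset_leq_card.
by apply/subsetP => x; rewrite !inE => ->; case: eqP.
Qed.

(** * Simultaneous diagonalisation by congruence *)

(** Left multiplication adds [x c 0] times row [a] to each row [c]. *)
Definition transvection (K : fieldType) (n : nat) (x : 'cV[K]_n) (a : 'I_n) :
    'M[K]_n := 1%:M + x *m delta_mx 0 a.

Lemma transvection_unit (K : fieldType) (n : nat) (x : 'cV[K]_n) (a : 'I_n) :
  x a 0 = 0 -> transvection x a \in unitmx.
Proof.
move=> xa; have N2 : x *m delta_mx 0 a *m (x *m delta_mx 0 a) = 0 :> 'M[K]_n.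
  rewrite mulmxA -(mulmxA x) -rowE; suff -> : row a x = 0 by rewrite mulmx0 mul0mx.
  by apply/matrixP => i j; rewrite !mxE !ord1.
have /mulmx1_unit[] // : transvection x a *m (1%:M - x *m delta_mx 0 a) = 1%:M.
by rewrite mulmxBr mulmx1 mulmxDl mul1mx N2 addr0 addrK.
Qed.

Lemma transvection_congr (K : fieldType) (n : nat) (x : 'cV[K]_n) (a : 'I_n)
    (G : 'M[K]_n) (c b : 'I_n) :
  (transvection x a *m G *m (transvection x a)^T) c b =
  G c b + x c 0 * G a b + (G c a + x c 0 * G a a) * x b 0.
Proof.
have QG d : (transvection x a *m G) c d = G c d + x c 0 * G a d.
  rewrite mulmxDl mul1mx -mulmxA -rowE mxE; congr (_ + _).
  by rewrite mxE big_ord1 mxE.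
rewrite /transvection in QG *.
rewrite linearD /= trmx1 mulmxDr mulmx1 mxE trmx_mul trmx_delta mulmxA QG.
congr (_ + _); rewrite -colE mxE big_ord1 !mxE; congr (_ * _).
by rewrite -QG mxE.
Qed.

(** For an equivalence relation [e] this says block diagonal along the classes, without reordering
    the indices. *)
Definition mx_supported (K : fieldType) (n : nat) (e : rel 'I_n)
    (Q : 'M[K]_n) : Prop := forall a b, Q a b != 0 -> e a b.

Lemma mx_supported1 (K : fieldType) (n : nat) (e : rel 'I_n) :
  reflexive e -> mx_supported e (1%:M : 'M[K]_n).
Proof.
by move=> er a b; rewrite mxE; case: (a =P b) => [->|_]; rewrite ?er ?eqxx.
Qed.

Lemma mx_supportedM (K : fieldType) (n : nat) (e : rel 'I_n) (P Q : 'M[K]_n) :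
  transitive e -> mx_supported e P -> mx_supported e Q ->
  mx_supported e (P *m Q).
Proof.
move=> et hP hQ a b PQ; apply: contraNT PQ => nab; rewrite mxE big1 // => c _.
have [->|/hP ac] := eqVneq (P a c) 0; first by rewrite mul0r.
have [->|/hQ cb] := eqVneq (Q c b) 0; first by rewrite mulr0.
by rewrite (et _ _ _ ac cb) in nab.
Qed.

Lemma mx_supported_tr (K : fieldType) (n : nat) (e : rel 'I_n) (Q : 'M[K]_n) :
  ssrbool.symmetric e -> mx_supported e Q -> mx_supported e Q^T.
Proof. by move=> es hQ a b; rewrite mxE es; apply: hQ. Qed.

Lemma mx_supported_transvection (K : fieldType) (n : nat) (e : rel 'I_n)
    (x : 'cV[K]_n) (a : 'I_n) :
  reflexive e -> (forall c, x c 0 != 0 -> e c a) ->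
  mx_supported e (transvection x a).
Proof.
move=> er hx c b; rewrite /transvection !mxE big_ord1 !mxE eqxx /=.
case: (c =P b) => [->|_]; rewrite ?er // add0r.
by case: (b =P a) => [->|_]; rewrite ?mulr0 ?eqxx // mulr1; apply: hx.
Qed.

(** The rows still to be cleared; its cardinality is the induction measure of [block_congr_diag]. *)
Definition offdiag (K : fieldType) (n : nat) (G : 'M[K]_n) : {set 'I_n} :=
  [set c | [exists b, (b != c) && (G c b != 0)]].

Lemma offdiagPn (K : fieldType) (n : nat) (G : 'M[K]_n) (c : 'I_n) :
  reflect (forall b, b != c -> G c b = 0) (c \notin offdiag G).
Proof.
rewrite inE negb_exists; apply: (iffP forallP) => h b.
  by move=> bc; have := h b; rewrite bc negbK => /eqP.
by case: eqP => //= /eqP /h ->; rewrite eqxx.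
Qed.

(** One step of symmetric Gaussian elimination: the pivot at [a] clears row and column [a]. A row
    that is already diagonal has multiplier 0 and stays as it is. *)
Lemma congr_pivot (K : fieldType) (n : nat) (e : rel 'I_n) (G : 'M[K]_n)
    (a : 'I_n) :
  reflexive e -> G^T = G -> mx_supported e G -> G a a != 0 ->
  exists Q : 'M[K]_n, [/\ Q \in unitmx, mx_supported e Q &
    offdiag (Q *m G *m Q^T) \subset offdiag G :\ a].
Proof.
move=> er Gs Ge Gaa.
have GC c b : G c b = G b c by rewrite -[in LHS]Gs mxE.
pose x : 'cV[K]_n := \col_c (if c == a then 0 else - G c a / G a a).
have xa : x a 0 = 0 by rewrite mxE eqxx.
have xc c : c != a -> G c a + x c 0 * G a a = 0.
  by move=> /negbTE ca; rewrite mxE ca mulfVK // subrr.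
exists (transvection x a); split; first exact: transvection_unit.
  apply: mx_supported_transvection => // c; rewrite mxE.
  case: (c =P a) => [->|_]; rewrite ?er //.
  by rewrite mulf_eq0 oppr_eq0 => /norP[/Ge].
apply/subsetP => c; apply: contraLR; rewrite in_setD1 negb_and negbK => hc.
apply/offdiagPn => b bc; rewrite transvection_congr.
have [ca|ca] := eqVneq c a.
  by rewrite ca xa !mul0r !addr0 GC mulrC xc // -ca.
move: hc; rewrite (negbTE ca) /= => /offdiagPn hc.
have xc0 : x c 0 = 0 by rewrite mxE (negbTE ca) hc ?oppr0 ?mul0r // eq_sym.
by rewrite xc // mul0r addr0 xc0 mul0r addr0 hc.
Qed.

(** Lagrange reduction of a quadratic form. Every row operation combines rows of one class only, so
    [Q] inherits the block structure. *)
Lemma block_congr_diag (K : numFieldType) (n : nat) (e : rel 'I_n)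
    (G : 'M[K]_n) :
  equivalence_rel e -> G^T = G -> mx_supported e G ->
  exists Q : 'M[K]_n, [/\ Q \in unitmx, mx_supported e Q &
    is_diag_mx (Q *m G *m Q^T)].
Proof.
move=> /equivalence_relP[er etl].
have es : ssrbool.symmetric e.
  by move=> x y; apply/idP/idP => /etl <-; apply: er.
have et : transitive e by move=> y x z /etl ->.
elim: {G}_.+1 {-2}G (ltnSn #|offdiag G|) => // m IH G hm Gs Ge.
have [N0|[a aN]] := set_0Vmem (offdiag G).
  exists 1%:M; split; [exact: unitmx1|exact: mx_supported1|].
  rewrite mul1mx trmx1 mulmx1; apply/is_diag_mxP => i j ij.
  have /offdiagPn -> // : i \notin offdiag G by rewrite N0 inE.
  by apply: contraNneq ij => ->.
have congrs (Q : 'M[K]_n) : (Q *m G *m Q^T)^T = Q *m G *m Q^T.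
  by rewrite !trmx_mul trmxK Gs mulmxA.
have congre (Q : 'M[K]_n) : mx_supported e Q -> mx_supported e (Q *m G *m Q^T).
  by move=> Qe; do 2?[apply: mx_supportedM => //]; apply: mx_supported_tr.
(* It suffices to produce a nonzero diagonal entry in a row still to be cleared, without spoiling a
   cleared row; pivoting there lowers the measure. *)
suff [Q1 [a' [Q1u Q1e a'N subN Gaa]]] : exists Q1 a', [/\ Q1 \in unitmx,
    mx_supported e Q1, a' \in offdiag G,
    offdiag (Q1 *m G *m Q1^T) \subset offdiag G &
    (Q1 *m G *m Q1^T) a' a' != 0].
  have [Q2 [Q2u Q2e sub2]] := congr_pivot er (congrs Q1) (congre _ Q1e) Gaa.
  have Q21 : Q2 *m (Q1 *m G *m Q1^T) *m Q2^T = (Q2 *m Q1) *m G *m (Q2 *m Q1)^T.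
    by rewrite trmx_mul !mulmxA.
  have Q21e : mx_supported e (Q2 *m Q1) by apply: mx_supportedM.
  have [|||Q [Qu Qe Qd]] := IH ((Q2 *m Q1) *m G *m (Q2 *m Q1)^T).
  - rewrite -Q21; rewrite ltnS in hm; apply: leq_trans hm; apply: proper_card.
    apply: sub_proper_trans sub2 _; apply: sub_proper_trans (setSD _ subN) _.
    exact: properD1.
  - exact: congrs.
  - exact: congre.
  exists (Q *m (Q2 *m Q1)); split.
  - by rewrite !unitmx_mul Qu Q2u Q1u.
  - exact: mx_supportedM.
  - by rewrite trmx_mul !mulmxA; rewrite !mulmxA in Qd.
have GC c b : G c b = G b c by rewrite -[in LHS]Gs mxE.
move: (aN); rewrite inE => /existsP[b /andP[ba Gab]].
have triv c : c \in offdiag G -> G c c != 0 -> exists Q1 a', [/\ Q1 \in unitmx,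
    mx_supported e Q1, a' \in offdiag G,
    offdiag (Q1 *m G *m Q1^T) \subset offdiag G &
    (Q1 *m G *m Q1^T) a' a' != 0].
  move=> cN Gc; exists 1%:M, c; rewrite mul1mx trmx1 mulmx1.
  by split; rewrite ?unitmx1 //; apply: mx_supported1.
have [Gaa|/triv] := eqVneq (G a a) 0; last exact.
have bN : b \in offdiag G.
  by rewrite inE; apply/existsP; exists a; rewrite eq_sym ba GC.
have [Gbb|/triv] := eqVneq (G b b) 0; last exact.
(* Adding row b to row a turns the diagonal entry at a into 2 * G a b. *)
exists (transvection (delta_mx a 0) b), a; split=> //.
- by apply: transvection_unit; rewrite mxE (negbTE ba).
- apply: mx_supported_transvection => // c; rewrite mxE eqxx andbT.
  by case: (c =P a) => [->|_]; rewrite ?eqxx //= => _; apply: Ge.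
- apply/subsetP => c; apply: contraLR => cN; apply/offdiagPn => d dc.
  have ca : c != a by apply: contraNneq cN => ->.
  have cb : c != b by apply: contraNneq cN => ->.
  move/offdiagPn: cN => cN.
  rewrite transvection_congr !mxE (negbTE ca) /= !mul0r !addr0.
  by rewrite !cN ?mul0r ?addr0 // eq_sym.
- rewrite transvection_congr !mxE !eqxx /= !mul1r mulr1 Gaa Gbb add0r addr0.
  by rewrite (GC b a) -mulr2n mulrn_eq0.
Qed.

(** Values outside the current span are added until none is left; the dimension bounds the number of
    steps. This reduces an infinite family of matrices to a finite list, as simultaneous
    diagonalisation requires. *)
Lemma finite_span (K : fieldType) (V : vectType K) (X : Type) (phi : X -> V)
    (Z : X -> Prop) :
  exists2 s : seq V, (forall y, y \in s -> exists2 x, Z x & y = phi x) &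
    forall x, Z x -> phi x \in <<s>>%VS.
Proof.
suff H m (s : seq V) : (\dim {:V} - \dim <<s>> < m)%N ->
    (forall y, y \in s -> exists2 x, Z x & y = phi x) ->
    exists2 s : seq V, (forall y, y \in s -> exists2 x, Z x & y = phi x) &
      forall x, Z x -> phi x \in <<s>>%VS.
  exact: (H _ [::] (ltnSn _)).
elim: m s => // m IH s hm hs.
have [h|/existsNP[x /not_implyP[Zx nx]]] :=
  pselect (forall x, Z x -> phi x \in <<s>>%VS); first by exists s.
apply: (IH (phi x :: s)); last first.
  by move=> y; rewrite inE => /predU1P[->|/hs //]; exists x.
rewrite ltnS in hm; apply: leq_trans hm; apply: ltn_sub2l.
  rewrite ltn_neqAle dimvS ?subvf // andbT; apply/negP => /eqP sf.
  apply: nx; have /eqP -> : <<s>>%VS == fullv by rewrite eqEdim subvf sf /=.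
  exact: memvf.
rewrite span_cons ltn_neqAle dimvS ?addvSr // andbT; apply/negP => /eqP sf.
apply: nx; have /eqP -> : <<s>>%VS == (<[phi x]> + <<s>>)%VS.
  by rewrite eqEdim addvSr sf /=.
exact: subvP (addvSl _ _) _ (memv_line _).
Qed.

(** The identity minus a projection onto [W]. For matrices, an entry of [L] is a linear form that
    vanishes on [W]. *)
Lemma separating_endo (K : fieldType) (V : vectType K) (W : {vspace V})
    (v : V) :
  v \notin W -> exists2 L : 'End(V), forall w, w \in W -> L w = 0 & L v != 0.
Proof.
move=> vW; exists (\1 - projv W)%VF => [w wW|].
  by rewrite !lfunE /= lfunE /= opp_lfunE projv_id // subrr.
rewrite !lfunE /= opp_lfunE id_lfunE subr_eq0; apply: contraNneq vW => ->.
exact: memv_proj.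
Qed.

Lemma span_closed (K : fieldType) (V : vectType K) (P : V -> Prop)
    (s : seq V) :
  P 0 -> (forall k u v, P u -> P v -> P (k *: u + v)) ->
  (forall y, y \in s -> P y) -> forall v, v \in <<s>>%VS -> P v.
Proof.
move=> P0 PD Ps v /(@coord_span _ _ _ (in_tuple s)) ->.
apply: big_rec => // i x _ Px; apply: PD => //.
by apply: Ps; apply: mem_nth.
Qed.

(** The matrices in [As] are self-adjoint for [B], so distinct joint eigenspaces are orthogonal.
    Inside one joint eigenspace every basis is an eigenbasis, so an orthogonal one can be chosen. *)
Lemma simult_congr_diag (K : numFieldType) (n : nat) (B : 'M[K]_n)
    (As : seq 'M[K]_n) :
  B \in unitmx -> B^T = B -> (forall A, A \in As -> (B *m A)^T = B *m A) ->
  (forall A A', A \in As -> A' \in As -> A *m A' = A' *m A) ->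
  (forall A, A \in As -> diagonalizable A) ->
  exists2 C : 'M[K]_n, C \in unitmx &
    forall A, A \in As -> is_diag_mx (C *m (B *m A) *m C^T).
Proof.
move=> Bu Bs Asym Acomm Adiag.
have [|P Pu /allP/= Pd] := (codiagonalizableP As).1.
  by split=> [A A' hA hA'|]; [apply: Acomm | apply: Adiag].
pose Lam A := P *m A *m invmx P.
have LamD A : A \in As -> is_diag_mx (Lam A).
  by move=> /Pd; rewrite /similar_to conjumx.
have LamP A : P *m A = Lam A *m P by rewrite mulmxKV.
(* G is the form B^-1 in the eigenbasis P. It commutes with every Lam A, so it
   is block diagonal along the joint eigenspaces. *)
pose G := P *m invmx B *m P^T.
have iBs : (invmx B)^T = invmx B by rewrite trmx_inv Bs.
have Gs : G^T = G by rewrite !trmx_mul trmxK iBs mulmxA.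
have LamG A : Lam A *m G = P *m (A *m invmx B) *m P^T.
  by rewrite !mulmxA -LamP -!mulmxA.
have AiB A : A \in As -> (A *m invmx B)^T = A *m invmx B.
  move=> /Asym; rewrite !trmx_mul iBs Bs => AB.
  by rewrite -{2}[A](mulKmx Bu) -AB !mulmxA mulmxK.
have LamGs A : A \in As -> (Lam A *m G)^T = Lam A *m G.
  by move=> hA; rewrite LamG trmx_mul trmxK (trmx_mul P) AiB // mulmxA.
(* The classes of [e] are the joint eigenspaces. *)
pose e a b := all (fun A => Lam A a a == Lam A b b) As.
have diagM (X Y : 'M[K]_n) a b : is_diag_mx X -> (X *m Y) a b = X a a * Y a b.
  move=> /is_diag_mxP X0; rewrite mxE (bigD1 a) //= big1 ?addr0 // => c ca.
  by rewrite X0 ?mul0r // eq_sym.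
have Mdiag (X Y : 'M[K]_n) a b : is_diag_mx X -> (Y *m X) a b = Y a b * X b b.
  move=> /is_diag_mxP X0; rewrite mxE (bigD1 b) //= big1 ?addr0 // => c ca.
  by rewrite X0 ?mulr0.
have [] := @block_congr_diag K n e G.
- apply/equivalence_relP; split=> [a|a b]; first by apply/allP => A _.
  move/allP => ab c; apply: eq_in_all => A /ab /eqP ->.
  by [].
- exact: Gs.
- move=> a b Gab; apply/allP => A hA.
  have E : (Lam A *m G) a b = (Lam A *m G) b a.
    by rewrite -[in RHS](LamGs _ hA) [RHS]mxE.
  have GC : G b a = G a b by rewrite -[in LHS]Gs mxE.
  by apply/eqP/(mulIf Gab); rewrite -[in RHS]GC -!diagM ?LamD.
(* The factor [invmx B] cancels [B] in [B *m A], leaving [Q *m Lam A *m G *m Q^T]. Each [Lam A] is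
   scalar on the blocks of [Q], so it commutes with [Q]. *)
move=> Q [Qu Qe Qd]; exists (Q *m P *m invmx B).
  by rewrite !unitmx_mul Qu Pu unitmx_inv.
move=> A hA.
have QL : Q *m Lam A = Lam A *m Q.
  apply/matrixP => a b; rewrite (Mdiag (Lam A)) ?(diagM (Lam A)) ?LamD // mulrC.
  have [->|/Qe/allP/(_ _ hA)/eqP ->//] := eqVneq (Q a b) 0.
  by rewrite !mulr0.
have -> : Q *m P *m invmx B *m (B *m A) *m (Q *m P *m invmx B)^T
    = Lam A *m (Q *m G *m Q^T).
  rewrite !trmx_mul iBs !mulmxA mulmxKV // -QL -(mulmxA Q) LamP.
  by rewrite /G !mulmxA.
apply/is_diag_mxP => a b ab; rewrite diagM ?LamD //.
by rewrite (is_diag_mxP Qd) ?mulr0.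
Qed.

(** * Symmetric tensors and linear substitutions *)

Lemma poly_vanishing (K : numFieldType) (p : {poly K}) :
  (forall y, p.[y] = 0) -> p = 0.
Proof.
move=> p0; apply/eqP; apply: contraT => pn0.
have := @max_poly_roots _ p [seq i%:R | i <- iota 0 (size p)] pn0.
rewrite size_map size_iota ltnn => h; rewrite h //.
  by apply/allP => y _; rewrite /root p0.
by rewrite map_inj_uniq ?iota_uniq //; apply: mulrIn; apply: oner_neq0.
Qed.

(** As a univariate polynomial in [x i] the sum has only zero values, so its coefficient of degree
    [k] is zero. *)
Lemma vanishing_exponent (K : numFieldType) (I J : finType) (P : pred J)
    (c : J -> K) (m : J -> I -> nat) (i : I) (k : nat) :
  (forall x : I -> K, \sum_(t | P t) c t * \prod_i x i ^+ m t i = 0) ->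
  forall x : I -> K,
    \sum_(t | P t && (m t i == k)) c t * \prod_i x i ^+ m t i = 0.
Proof.
move=> h x.
pose p := \sum_(t | P t) (c t * \prod_(l | l != i) x l ^+ m t l) *: 'X^(m t i).
have p0 : p = 0.
  apply: poly_vanishing => y; rewrite horner_sum.
  rewrite -[RHS](h (fun l => if l == i then y else x l)).
  apply: eq_bigr => t _; rewrite hornerZ hornerXn -mulrA; congr (_ * _).
  rewrite [in RHS](bigD1 i) //= eqxx mulrC; congr (_ * _).
  by apply: eq_bigr => l /negbTE ->.
transitivity (p`_k * x i ^+ k); last by rewrite p0 coef0 mul0r.
rewrite coef_sum mulr_suml big_mkcondr /=.
apply: eq_bigr => t _; rewrite coefZ coefXn eq_sym.
case: eqP => [->|_]; last by rewrite mulr0 mul0r.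
by rewrite mulr1 (bigD1 i) //= mulrA mulrAC -mulrA mulrA.
Qed.

(** Exponents are isolated one variable at a time, then the remaining sum is evaluated at the
    all-ones point. Several [t] may share an exponent vector, hence a sum of coefficients. *)
Lemma vanishing_coef (K : numFieldType) (I J : finType)
    (c : J -> K) (m : J -> I -> nat) (m0 : I -> nat) :
  (forall x : I -> K, \sum_t c t * \prod_i x i ^+ m t i = 0) ->
  \sum_(t | [forall i, m t i == m0 i]) c t = 0.
Proof.
move=> h.
suff H (r : seq I) (x : I -> K) :
    \sum_(t | all (fun i => m t i == m0 i) r) c t * \prod_i x i ^+ m t i = 0.
  rewrite -[RHS](H (enum I) (fun=> 1)); apply: eq_big => [t|t _].
    apply/forallP/allP => [mt i _|mt i]; first exact: mt.
    by apply: mt; rewrite mem_enum.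
  by rewrite big1 ?mulr1 // => i _; rewrite expr1n.
elim: r x => [|i r IH] x; first exact: h.
rewrite -[RHS](vanishing_exponent i (m0 i) IH x); apply: eq_bigl => t.
by rewrite /= andbC.
Qed.

Lemma prod_count (K : fieldType) (I J : finType) (g : J -> I) (x : I -> K) :
  \prod_j x (g j) = \prod_i x i ^+ (\sum_j (g j == i : nat)).
Proof.
under [RHS]eq_bigr do rewrite expr_sum.
rewrite exchange_big /=; apply: eq_bigr => j _.
rewrite (bigD1 (g j)) //= eqxx expr1 big1 ?mulr1 // => i.
by rewrite eq_sym => /negbTE ->; rewrite expr0.
Qed.

Lemma eq_index_mnm (K : Type) (n d : nat) (T : tensor K n d) (t u : d.-tuple 'I_n) :
  symmetric_tensor T -> index_mnm t = index_mnm u -> T t = T u.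
Proof. by move=> Ts /index_mnm_perm[s ->]; apply: Ts. Qed.

Definition mform (K : fieldType) (n d : nat) (T : tensor K n d)
    (x : 'I_d -> 'I_n -> K) : K :=
  \sum_t T t * \prod_p x p (tnth t p).

(** The tensor after the substitution of [A x] for [x]: the multilinear form evaluated at the
    columns of [A] listed by [s]. *)
Definition tensor_subst (K : fieldType) (n d : nat) (T : tensor K n d)
    (A : 'M[K]_n) : tensor K n d :=
  fun s => mform T (fun p i => A i (tnth s p)).

Lemma sum_tuple_distr (R : comPzRingType) (n d : nat) (F : 'I_d -> 'I_n -> R) :
  \prod_p \sum_j F p j = \sum_(s : d.-tuple 'I_n) \prod_p F p (tnth s p).
Proof.
rewrite bigA_distr_bigA /=.
rewrite (reindex (fun s : d.-tuple 'I_n => [ffun p => tnth s p])) /=.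
  by apply: eq_bigr => s _; apply: eq_bigr => p _; rewrite ffunE.
exists (fun f : {ffun 'I_d -> 'I_n} => [tuple f p | p < d]) => [s _|f _].
  by apply: eq_from_tnth => p; rewrite tnth_mktuple ffunE.
by apply/ffunP => p; rewrite ffunE tnth_mktuple.
Qed.

Lemma mform_subst (K : fieldType) (n d : nat) (T : tensor K n d) (A : 'M[K]_n)
    (x : 'I_d -> 'I_n -> K) :
  mform (tensor_subst T A) x = mform T (fun p i => \sum_j A i j * x p j).
Proof.
rewrite /mform /tensor_subst /mform.
under eq_bigr do rewrite mulr_suml.
rewrite exchange_big /=; apply: eq_bigr => t _.
rewrite sum_tuple_distr mulr_sumr; apply: eq_bigr => s _.
by rewrite -mulrA -big_split.
Qed.

Lemma mform_perm (K : fieldType) (n d : nat) (T : tensor K n d) (s : 'S_d)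
    (x : 'I_d -> 'I_n -> K) :
  symmetric_tensor T -> mform T (fun p => x (s p)) = mform T x.
Proof.
move=> Ts; rewrite /mform.
rewrite [RHS](reindex (fun t : d.-tuple 'I_n =>
  [tuple tnth t (s^-1%g p) | p < d])) /=.
  apply: eq_bigr => t _; rewrite Ts; congr (_ * _).
  rewrite [RHS](reindex_inj (@perm_inj _ s)) /=.
  by apply: eq_bigr => p _; rewrite tnth_mktuple permK.
exists (fun t : d.-tuple 'I_n => [tuple tnth t (s p) | p < d]) => t _;
  by apply: eq_from_tnth => p; rewrite !tnth_mktuple ?permK ?permKV.
Qed.

Lemma tensor_subst_sym (K : fieldType) (n d : nat) (T : tensor K n d)
    (A : 'M[K]_n) : symmetric_tensor T -> symmetric_tensor (tensor_subst T A).
Proof.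
move=> Ts s t; rewrite /tensor_subst.
rewrite -[RHS](mform_perm s _ Ts); apply: eq_bigr => u _; congr (_ * _).
by apply: eq_bigr => p _; rewrite tnth_mktuple.
Qed.

Lemma tensor_poly_homog (K : numFieldType) (n d : nat) (T : tensor K n d) :
  tensor_poly T \is d.-homog.
Proof.
apply: rpred_sum => t _; apply: rpredZ; rewrite mprodXE dhomogX.
by apply/eqP; exact: mdeg_index_mnm.
Qed.

Lemma lin_subst_tensor_poly (K : numFieldType) (n d : nat) (T : tensor K n d)
    (A : 'M[K]_n) :
  lin_subst (tensor_poly T) A = tensor_poly (tensor_subst T A).
Proof.
rewrite /lin_subst /tensor_poly raddf_sum /=.
under [RHS]eq_bigr do rewrite scaler_suml.
rewrite [RHS]exchange_big /=; apply: eq_bigr => t _.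
rewrite comp_mpolyZ rmorph_prod /=.
under eq_bigr do rewrite comp_mpolyXU -tnth_nth tnth_mktuple.
rewrite sum_tuple_distr scaler_sumr; apply: eq_bigr => s _.
by rewrite scaler_prod scalerA.
Qed.

(** Both sides are symmetric tensors of the same polynomial, so uniqueness in [sym_tensorP]
    identifies them. *)
Lemma sym_tensor_subst (K : numFieldType) (n d : nat) (f : {mpoly K[n]})
    (A : 'M[K]_n) :
  f \is d.-homog ->
  @sym_tensor K n d (lin_subst f A) = tensor_subst (@sym_tensor K n d f) A.
Proof.
move=> /(@sym_tensorP K n d)[Ts fE _].
have lE : lin_subst f A = tensor_poly (tensor_subst (@sym_tensor K n d f) A).
  by rewrite -lin_subst_tensor_poly fE.
have := tensor_poly_homog (tensor_subst (@sym_tensor K n d f) A).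
rewrite -lE => /(@sym_tensorP K n d)[_ _]; move/(_ _ _ (esym lE)) => -> //.
exact: tensor_subst_sym.
Qed.

Lemma lin_substM (K : numFieldType) (n : nat) (f : {mpoly K[n]})
    (A B : 'M[K]_n) : lin_subst (lin_subst f A) B = lin_subst f (A *m B).
Proof.
rewrite /lin_subst [RHS]comp_mpolyEX (comp_mpolyEX f) raddf_sum /=.
apply: eq_bigr => m _.
rewrite !comp_mpolyZ; congr (_ *: _); rewrite !comp_mpolyX rmorph_prod /=.
apply: eq_bigr => i _; rewrite rmorphXn /= !tnth_mktuple; congr (_ ^+ _).
rewrite raddf_sum /=.
under eq_bigr do rewrite comp_mpolyZ comp_mpolyXU -tnth_nth tnth_mktuple
  scaler_sumr.
rewrite exchange_big /=; apply: eq_bigr => j _; rewrite mxE scaler_suml.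
by apply: eq_bigr => l _; rewrite scalerA.
Qed.

Lemma lin_subst1 (K : numFieldType) (n : nat) (f : {mpoly K[n]}) :
  lin_subst f 1%:M = f.
Proof.
rewrite -[RHS]comp_mpoly_id; congr (_ \mPo _); apply: eq_from_tnth => i.
rewrite !tnth_mktuple (bigD1 i) //= mxE eqxx scale1r big1 ?addr0 // => j.
by rewrite mxE eq_sym => /negbTE ->; rewrite scale0r.
Qed.

(** * The matrices H(v) *)

(** The [e.+2] slots split into the first [e], embedded by [init_ord], and the two free slots
    [penult e] and [ord_max] of the bilinear form. *)
Definition init_ord (e : nat) (p : 'I_e) : 'I_e.+2 :=
  widen_ord (leqnSn _) (widen_ord (leqnSn _) p).

Definition penult (e : nat) : 'I_e.+2 := widen_ord (leqnSn _) ord_max.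

Definition dirs (K : Type) (n e : nat) (v x y : 'I_n -> K) (p : 'I_e.+2) :
    'I_n -> K :=
  if (p < e)%N then v else if p == penult e then x else y.

Definition delta (K : fieldType) (n : nat) (a i : 'I_n) : K := (i == a)%:R.

(* Up to the factor d (d - 1), the Hessian matrix at v of the polynomial of T. *)
Definition hess (K : fieldType) (n e : nat) (T : tensor K n e.+2)
    (v : 'I_n -> K) : 'M[K]_n :=
  \matrix_(a, b) mform T (dirs v (delta K a) (delta K b)).

Lemma mform_dirs (K : fieldType) (n e : nat) (T : tensor K n e.+2)
    (v x y : 'I_n -> K) :
  mform T (dirs v x y) =
  \sum_t T t * (\prod_p v (tnth t (init_ord p)) *
    (x (tnth t (penult e)) * y (tnth t ord_max))).
Proof.
apply: eq_bigr => t _; congr (_ * _).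
rewrite !big_ord_recr /= -mulrA /dirs /= ltnn eqxx [(e.+1 < e)%N]ltnNge leqnSn /=.
rewrite -val_eqE /= gtn_eqF //; congr (_ * _).
by apply: eq_bigr => p _; rewrite ltn_ord.
Qed.

Lemma hessE (K : fieldType) (n e : nat) (T : tensor K n e.+2)
    (v : 'I_n -> K) (a b : 'I_n) :
  hess T v a b =
  \sum_t T t * (\prod_p v (tnth t (init_ord p)) *
    ((tnth t (penult e) == a)%:R * (tnth t ord_max == b)%:R)).
Proof. by rewrite mxE mform_dirs. Qed.

Lemma eq_mform (K : fieldType) (n d : nat) (T : tensor K n d)
    (x y : 'I_d -> 'I_n -> K) :
  (forall p i, x p i = y p i) -> mform T x = mform T y.
Proof.
by move=> xy; apply: eq_bigr => t _; congr (_ * _); apply: eq_bigr.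
Qed.

Lemma eq_hess (K : fieldType) (n e : nat) (T : tensor K n e.+2)
    (v w : 'I_n -> K) : v =1 w -> hess T v = hess T w.
Proof.
move=> vw; apply/matrixP => a b; rewrite !hessE; apply: eq_bigr => t _.
by congr (_ * (_ * _)); apply: eq_bigr.
Qed.

Lemma mform_hess (K : fieldType) (n e : nat) (T : tensor K n e.+2)
    (v x y : 'I_n -> K) :
  mform T (dirs v x y) = \sum_a \sum_b x a * hess T v a b * y b.
Proof.
under eq_bigr do under eq_bigr do rewrite hessE mulr_sumr mulr_suml.
under eq_bigr do rewrite exchange_big.
rewrite exchange_big mform_dirs; apply: eq_bigr => t _ /=.
rewrite (bigD1 (tnth t (penult e))) //= [X in _ + X]big1 ?addr0; last first.
  by move=> a /negbTE ht; rewrite big1 // => b _; rewrite eq_sym ht !(mul0r, mulr0).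
rewrite (bigD1 (tnth t ord_max)) //= [X in _ + X]big1 ?addr0; last first.
  by move=> b /negbTE ht; rewrite eq_sym ht !mulr0 mul0r.
by rewrite !eqxx !mulr1 [in RHS](mulrC (x _)) -!mulrA.
Qed.

Lemma hess_subst (K : fieldType) (n e : nat) (T : tensor K n e.+2)
    (A : 'M[K]_n) (v : 'I_n -> K) :
  hess (tensor_subst T A) v =
  A^T *m hess T (fun i => \sum_j A i j * v j) *m A.
Proof.
have Adelta i a : \sum_j A i j * delta K a j = A i a.
  rewrite (bigD1 a) //= /delta eqxx mulr1 big1 ?addr0 // => j /negbTE ->.
  exact: mulr0.
apply/matrixP => a b; rewrite [LHS]mxE mform_subst.
transitivity (mform T (dirs (fun i => \sum_j A i j * v j) (A^~ a) (A^~ b))).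
  apply: eq_mform => p i; rewrite /dirs.
  by case: (p < e)%N => //; case: (p == penult e).
rewrite mform_hess exchange_big !mxE; apply: eq_bigr => c _.
by rewrite !mxE mulr_suml; apply: eq_bigr => c' _; rewrite !mxE.
Qed.

(** Swapping the last two slots exchanges the two basis vectors and fixes every copy of [v]. *)
Lemma hess_sym (K : fieldType) (n e : nat) (T : tensor K n e.+2)
    (v : 'I_n -> K) : symmetric_tensor T -> (hess T v)^T = hess T v.
Proof.
move=> Ts; apply/matrixP => a b; rewrite !mxE.
rewrite -(mform_perm (tperm (penult e) ord_max) _ Ts); apply: eq_mform => p i.
have pm : penult e == ord_max = false by rewrite -val_eqE /= ltn_eqF.
rewrite /dirs; case: tpermP => [->|->|/eqP pp /eqP pq] /=.
- by rewrite ltnn eqxx [(e.+1 < e)%N]ltnNge leqnSn /= eq_sym pm.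
- by rewrite ltnn eqxx [(e.+1 < e)%N]ltnNge leqnSn /= eq_sym pm.
case: ltnP => // ep; exfalso; move: pp pq; rewrite -!val_eqE /=.
by have := ltn_ord p; rewrite !ltnS leq_eqVlt => /orP[->//|]; rewrite ltnS => pe;
  rewrite eqn_leq pe ep.
Qed.

Lemma bar_slice_hess (K : fieldType) (n e : nat) (T : tensor K n e.+2)
    (k : 'I_n) : bar_slice T k = hess T (delta K k).
Proof.
apply/matrixP => a b; rewrite !mxE /mform.
set s := [tuple _ | _ < _].
have sE p : dirs (delta K k) (delta K a) (delta K b) p = delta K (tnth s p).
  rewrite tnth_mktuple /dirs /= nth_cat size_nseq subn2 /=.
  case: ltnP => [pe|ep]; first by rewrite nth_nseq pe.
  have [->|pp] := eqVneq p (penult e); first by rewrite /= subnn.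
  suff -> : (p = e.+1 :> nat) by rewrite subSnn.
  have := ltn_ord p; rewrite ltnS leq_eqVlt => /orP[/eqP//|]; rewrite ltnS => pe.
  by move: pp; rewrite -val_eqE /= eqn_leq pe ep.
rewrite (bigD1 s) //= big1 ?mulr1 => [|p _]; last by rewrite sE /delta eqxx.
rewrite big1 ?addr0 // => t ts.
have [p tp] : exists p, tnth t p != tnth s p.
  apply/existsP; apply: contraR ts; rewrite negb_exists => /forallP h.
  by apply/eqP/eq_from_tnth => p; apply/eqP; have := h p; rewrite negbK.
by rewrite (bigD1 p) //= sE /delta (negbTE tp) mul0r mulr0.
Qed.

Lemma tnth_nseq_const (T : Type) (d : nat) (k : T) (p : 'I_d) :
  tnth [tuple of nseq d k] p = k.
Proof. by rewrite (tnth_nth k) nth_nseq ltn_ord. Qed.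

Lemma sum_const_tuples (V : zmodType) (n d : nat) (F : d.+1.-tuple 'I_n -> V) :
  (forall t p q, tnth t p != tnth t q -> F t = 0) ->
  \sum_t F t = \sum_k F [tuple of nseq d.+1 k].
Proof.
move=> F0; rewrite (bigID (fun t => t == [tuple of nseq d.+1 (tnth t ord0)])) /=.
rewrite [X in _ + X]big1 ?addr0 => [|t tc].
  rewrite (reindex_onto (fun k => [tuple of nseq d.+1 k])
                        (fun t => tnth t ord0)) => [|t /eqP //].
  by apply: eq_bigl => k; rewrite tnth_nseq_const !eqxx.
have [p tp] : exists p, tnth t p != tnth t ord0.
  apply/existsP; apply: contraR tc; rewrite negb_exists => /forallP h.
  apply/eqP/eq_from_tnth => p; have := h p; rewrite negbK => /eqP ->.
  by rewrite tnth_nseq_const.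
exact: F0 tp.
Qed.

(** These are the diagonal tensors, those of linear combinations of pure powers of the variables. *)
Definition const_supported (K : fieldType) (n d : nat) (T : tensor K n d) :
  Prop := forall t p q, tnth t p != tnth t q -> T t = 0.

Lemma tensor_poly_const_supported (K : numFieldType) (n d : nat)
    (T : tensor K n d.+1) :
  const_supported T ->
  tensor_poly T = \sum_k T [tuple of nseq d.+1 k] *: 'X_k ^+ d.+1.
Proof.
move=> T0; rewrite /tensor_poly sum_const_tuples => [|t p q tpq].
  apply: eq_bigr => k _; congr (_ *: _).
  under eq_bigr do rewrite tnth_nseq_const.
  by rewrite prodr_const card_ord.
by rewrite (T0 _ _ _ tpq) scale0r.
Qed.

Lemma hess_const_supported (K : fieldType) (n e : nat) (T : tensor K n e.+2)
    (v : 'I_n -> K) :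
  const_supported T ->
  hess T v = diag_mx (\row_k (T [tuple of nseq e.+2 k] * v k ^+ e)).
Proof.
move=> T0; apply/matrixP => a b; rewrite hessE sum_const_tuples => [|t p q tpq].
  rewrite (bigD1 a) //= !tnth_nseq_const eqxx mul1r.
  rewrite [X in _ + X]big1 ?addr0 => [|k /negbTE ka].
    rewrite !mxE mulr_natr mulrnAr; congr (_ *+ _); congr (_ * _).
    under eq_bigr do rewrite tnth_nseq_const.
    by rewrite prodr_const card_ord.
  by rewrite !tnth_nseq_const ka mul0r !mulr0.
by rewrite (T0 _ _ _ tpq) mul0r.
Qed.

(** An off-diagonal entry of [hess T v] is a polynomial in [v] with zero values, so its coefficients
    vanish. By symmetry each coefficient is a positive multiple of a single entry of [T]. *)
Lemma diag_hess_const_supported (K : numFieldType) (n e : nat)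
    (T : tensor K n e.+2) :
  symmetric_tensor T -> (forall v, is_diag_mx (hess T v)) -> const_supported T.
Proof.
move=> Ts hD t0 p q tpq.
have H t : tnth t (penult e) != tnth t ord_max -> T t = 0.
  move: t => t0' ab; set a := tnth t0' _ in ab; set b := tnth t0' _ in ab.
  pose m (t : e.+2.-tuple 'I_n) i :=
    (\sum_(p < e) (tnth t (init_ord p) == i : nat))%N.
  pose c t := T t * ((tnth t (penult e) == a)%:R * (tnth t ord_max == b)%:R).
  have /(vanishing_coef (m t0')) : forall x, \sum_t c t * \prod_i x i ^+ m t i = 0.
    move=> x; have /is_diag_mxP/(_ _ _ ab) E := hD x.
    rewrite -[RHS]E hessE.
    apply: eq_bigr => t _; rewrite -mulrA; congr (_ * _).
    by rewrite mulrC -prod_count.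
  (* [Q] selects the tuples ending in [a], [b] whose first [e] entries rearrange those of [t0'].
     They share the entry [T t0'], and [t0'] is one of them, so their number is nonzero in [K]. *)
  pose Q t := [forall i, m t i == m t0' i] &&
              ((tnth t (penult e) == a) && (tnth t ord_max == b)).
  move=> c0; have : \sum_(t | Q t) T t0' = 0.
    rewrite -[RHS]c0 [RHS](bigID (fun t =>
      (tnth t (penult e) == a) && (tnth t ord_max == b))) /=.
    rewrite [X in _ + X]big1 ?addr0 => [|t /andP[_]]; last first.
      by rewrite /c; case: eqP; case: eqP; rewrite ?(mulr0, mul0r).
    apply: eq_bigr => t /andP[/forallP mt /andP[ta tb]].
    rewrite /c ta tb !mulr1; apply: eq_index_mnm => //; apply/mnmP => i.
    rewrite /index_mnm !mnm_sumE !big_ord_recr /= !mnm1E.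
    have /eqP := mt i; rewrite /m => mi.
    under eq_bigr do rewrite mnm1E.
    under [in RHS]eq_bigr do rewrite mnm1E.
    rewrite -/(penult e) (eqP ta) (eqP tb); congr (_ + _ + _)%N.
    exact: esym.
  rewrite sumr_const => /eqP; rewrite mulrn_eq0 => /orP[|/eqP //].
  move=> /eqP/eqP; rewrite -leqn0 leqNgt => /negP[]; apply/card_gt0P.
  by exists t0'; rewrite unfold_in /Q !eqxx !andbT; apply/forallP.
(* These swaps bring the entries at [p] and [q] into the last two slots; [s1 q] accounts for the
   first swap possibly moving [q]. *)
pose s1 := tperm (penult e) p; pose s2 := tperm ord_max (s1 q).
rewrite -(Ts (s2 * s1)%g t0); apply: H; rewrite !tnth_mktuple !permM.
have s12 : s2 (penult e) = penult e.
  apply: tpermD; first by rewrite -val_eqE /= gtn_eqF.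
  apply: contraNneq tpq => /(congr1 s1); rewrite tpermK tpermL => ->.
  by [].
by rewrite s12 tpermL /s2 tpermL tpermK.
Qed.

(** * Analysis of the algorithm *)

Lemma diag_hess_equivalent (K : numFieldType) (n e : nat) (f : {mpoly K[n]})
    (A : 'M[K]_n) (r : 'I_n -> K) (T := @sym_tensor K n e.+2 f) :
  f \is e.+2.-homog -> A \in unitmx -> hess T r \in unitmx ->
  (forall v, is_diag_mx (A^T *m hess T v *m A)) ->
  exists2 g : {mpoly K[n]}, in_Pd e.+2 g & equivalent f g.
Proof.
move=> hf Au Hu Hd.
have [Ts fE _] := @sym_tensorP K n e.+2 f hf.
pose T' := tensor_subst T A.
have T'c : const_supported T'.
  apply: diag_hess_const_supported; first exact: tensor_subst_sym.
  by move=> v; rewrite hess_subst.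
exists (lin_subst f A); last first.
  by exists (invmx A); rewrite ?unitmx_inv // lin_substM mulmxV // lin_subst1.
exists (fun k => T' [tuple of nseq e.+2 k]); last first.
  by rewrite -fE lin_subst_tensor_poly -tensor_poly_const_supported.
(* Since [A] maps [w] to [r], the matrix at [w] is congruent to [hess T r], hence invertible; being
   diagonal, it has no zero coefficient. *)
move=> k; pose w i := (invmx A *m \col_i r i) i 0.
have : hess T' w \in unitmx.
  rewrite hess_subst !unitmx_mul unitmx_tr Au andbT /=.
  rewrite (@eq_hess _ _ _ _ _ r) // => i.
  transitivity ((A *m (invmx A *m \col_i r i)) i 0); first by rewrite mxE.
  by rewrite mulKVmx // mxE.
rewrite hess_const_supported // unitmxE unitfE det_diag => /prodf_neq0 /(_ k isT).
by rewrite mxE mulf_eq0 => /norP[].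
Qed.

Lemma polyfun_hess (K : fieldType) (n e : nat) (T : tensor K n e.+2)
    (k a b : 'I_n) :
  polyfun e (fun x : 'I_n * 'I_n -> K => hess T (fun i => x (i, k)) a b).
Proof.
apply: (eq_polyfun (fun x => esym (hessE T (fun i => x (i, k)) a b))).
apply: polyfun_sum => t; apply: polyfunZ.
set c := _%:R * _%:R; apply: (@eq_polyfun _ _ _
  (fun x => c * \prod_p x (tnth t (init_ord p), k))) => [x|]; first exact: mulrC.
apply: polyfunZ; apply: (@polyfunW _ _ (\sum_(p < e) 1)%N).
  by rewrite sum1_card card_ord.
by apply: polyfun_prod => p; apply: polyfun_coord.
Qed.

Lemma polyfun_mulmx (K : fieldType) (I : finType) (k l m n p : nat)
    (A : (I -> K) -> 'M[K]_(m, n)) (B : (I -> K) -> 'M[K]_(n, p)) :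
  (forall a b, polyfun k (fun x => A x a b)) ->
  (forall a b, polyfun l (fun x => B x a b)) ->
  forall a b, polyfun (k + l) (fun x => (A x *m B x) a b).
Proof.
move=> hA hB a b.
apply: (@eq_polyfun _ _ _ (fun x => \sum_c A x a c * B x c b)) => [x|].
  by rewrite mxE.
by apply: polyfun_sum => c; apply: polyfunM.
Qed.

Lemma polyfun_linear (K : fieldType) (I : finType) (k m n p q : nat)
    (L : {linear 'M[K]_(m, n) -> 'M[K]_(p, q)})
    (A : (I -> K) -> 'M[K]_(m, n)) :
  (forall a b, polyfun k (fun x => A x a b)) ->
  forall a b, polyfun k (fun x => L (A x) a b).
Proof.
move=> hA a b.
apply: (@eq_polyfun _ _ _
  (fun x => \sum_i \sum_j L (delta_mx i j) a b * A x i j)) => [x|].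
  rewrite [A x in RHS]matrix_sum_delta linear_sum summxE; apply: eq_bigr => i _.
  rewrite linear_sum summxE; apply: eq_bigr => j _.
  by rewrite linearZ mxE mulrC.
by apply: polyfun_sum => i; apply: polyfun_sum => j; apply: polyfunZ.
Qed.

Lemma polyfun_det (K : fieldType) (n : nat) :
  polyfun n (fun x : 'I_n * 'I_n -> K => \det (\matrix_(i, j) x (i, j))).
Proof.
apply: (@eq_polyfun _ _ _
  (fun x => \sum_(s : 'S_n) (-1) ^+ s * \prod_i x (i, s i))) => [x|].
  by apply: eq_bigr => s _; congr (_ * _); apply: eq_bigr => i _; rewrite mxE.
apply: polyfun_sum => s; apply: polyfunZ; apply: (@polyfunW _ _ (\sum_(p < n) 1)%N).
  by rewrite sum1_card card_ord.
by apply: polyfun_prod => p; apply: polyfun_coord.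
Qed.

(** The slice at [k] is [M^T *m H k *m M], so the quotients of slices are conjugates by [M] of
    [iH0 *m H k]. Conjugation preserves commutation and diagonalisability. *)
Lemma algorithmE (K : numFieldType) (n e : nat) (hn : (2 < n)%N)
    (f : {mpoly K[n]}) (M : 'M[K]_n)
    (H := fun k => hess (@sym_tensor K n e.+2 f) (fun i => M i k))
    (o0 := Ordinal (ltnW (ltnW hn))) (o1 := Ordinal (ltnW hn))
    (o2 := Ordinal hn) (iH0 := invmx (H o0)) :
  f \is e.+2.-homog ->
  algorithm e.+2 hn f M =
  [&& M \in unitmx, H o0 \in unitmx, comm_mxb (iH0 *m H o1) (iH0 *m H o2) &
      `[< diagonalizable (iH0 *m H o1) >]].
Proof.
move=> hf.
have sliceE k : bar_slice (@sym_tensor K n e.+2 (lin_subst f M)) k =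
    M^T *m H k *m M.
  rewrite bar_slice_hess sym_tensor_subst // hess_subst /H; congr (_ *m _ *m _).
  apply: eq_hess => i; rewrite (bigD1 k) //= /delta eqxx mulr1 big1 ?addr0 //.
  by move=> j /negbTE ->; rewrite mulr0.
rewrite /algorithm !sliceE !unitmx_mul unitmx_tr.
have [Mu|] := boolP (M \in unitmx); last by [].
rewrite andbT /=; have [Hu|] := boolP (H o0 \in unitmx); last by [].
have quot k : invmx (M^T *m H o0 *m M) *m (M^T *m H k *m M) =
    conjmx (invmx M) (iH0 *m H k).
  rewrite conjVmx //.
  have -> : M^T *m H k *m M =
      M^T *m H o0 *m M *m (invmx M *m (iH0 *m H k) *m M).
    by rewrite !mulmxA mulmxK // mulmxK.
  by rewrite mulKmx // !unitmx_mul unitmx_tr Mu Hu.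
rewrite !quot /=; congr (_ && _).
  apply/eqP/eqP => [|E].
    rewrite -!conjmxM ?inE ?stablemx_unit ?unitmx_inv // => E.
    by rewrite -[LHS](conjmxVK _ Mu) E conjmxVK.
  by rewrite -!conjmxM ?inE ?stablemx_unit ?unitmx_inv // E.
apply/asboolP/asboolP => -[P Pu]; rewrite /similar_to.
  exists (P *m invmx M); first by rewrite unitmx_mul Pu unitmx_inv.
  by rewrite /similar_to conjuMumx ?unitmx_inv.
exists (P *m M); first by rewrite unitmx_mul Pu.
by rewrite /similar_to conjuMumx ?unitmx_inv // conjmxVK.
Qed.

(** Passes from counting to probability: a matrix over [S] is recoded as a function on index pairs,
    and the complement of [E] is counted. *)
Lemma prob_uniform_mx_ge (R : realType) (K : numFieldType) (n c : nat)
    (S : {fset K}) (E : pred 'M[K]_n) :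
  S != fset0 ->
  (#|{: S}| * #|[pred x : {ffun 'I_n * 'I_n -> S} |
             E (\matrix_(i, j) val (x (i, j)))]|
     <= c * #|{ffun 'I_n * 'I_n -> S}|)%N ->
  1 - c%:R / #|` S|%:R <= prob_uniform_mx R S (fun M => ~~ E M).
Proof.
move=> S0 hE; have s0 : (0 < #|` S|)%N by rewrite cardfs_gt0.
rewrite /prob_uniform_mx.
have -> : \prod_(i < n) \prod_(j < n) (#|` S|%:R)^-1 =
    (#|` S|%:R ^+ (n * n))^-1 :> R.
  by rewrite !prodr_const !card_ord -exprM exprVn.
rewrite sumr_const; set N := #|_|; set t := _ ^+ _.
have NE : (N = #|` S| ^ (n * n) - #|[pred M : 'M[S]_n | E (map_mx val M)]|)%N.
  have := cardC [pred M : 'M[S]_n | E (map_mx val M)].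
  rewrite card_mx cardfE => <-; rewrite addKn; apply: eq_card => M.
  by rewrite !inE.
have EN : #|[pred M : 'M[S]_n | E (map_mx val M)]| =
    #|[pred x : {ffun 'I_n * 'I_n -> S} | E (\matrix_(i, j) val (x (i, j)))]|.
  rewrite -(@card_image _ _ (fun M : 'M[S]_n => [ffun p => M p.1 p.2])).
    apply: eq_card => x; rewrite !inE; apply/imageP/idP => [[M + ->]|Ex].
      rewrite inE; congr (E _); apply/matrixP => i j.
      by rewrite !mxE ffunE.
    exists (\matrix_(i, j) x (i, j)); last first.
      by apply/ffunP => -[i j]; rewrite ffunE mxE.
    rewrite inE; congr (E _): Ex; apply/matrixP => i j.
    by rewrite !mxE.
  move=> M M' /ffunP MM; apply/matrixP => i j.
  by have := MM (i, j); rewrite !ffunE.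
rewrite -EN card_ffun card_prod !card_ord -cardfE in hE.
have NS : (#|[pred M : 'M[S]_n | E (map_mx val M)]| <= #|` S| ^ (n * n))%N.
  by rewrite cardfE -card_mx max_card.
rewrite NE -[_^-1 *+ _]mulr_natl natrB // natrX -/t.
have t0 : 0 < t by rewrite exprn_gt0 // ltr0n.
rewrite mulrBl divff ?lt0r_neq0 // lerD2l lerN2 ler_pdivrMr // mulrAC.
rewrite ler_pdivlMr ?ltr0n // /t -natrX -!natrM ler_nat mulnC.
by [].
Qed.

(** * Acceptance bound for polynomials not equivalent to a member of P_d *)

Lemma card_algorithm_accept (K : numFieldType) (n e : nat) (hn : (2 < n)%N)
    (S : finType) (v : S -> K) (f : {mpoly K[n]}) :
  injective v -> f \is e.+2.-homog ->
  ~ (exists2 g : {mpoly K[n]}, in_Pd e.+2 g & equivalent f g) ->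
  (#|S| * #|[pred x : {ffun 'I_n * 'I_n -> S} |
             algorithm e.+2 hn f (\matrix_(i, j) v (x (i, j)))]|
     <= (2 * e) * #|{ffun 'I_n * 'I_n -> S}|)%N.
Proof.
move=> vI hf fP.
set o0 := Ordinal (ltnW (ltnW hn)); set o1 := Ordinal (ltnW hn).
set o2 := Ordinal hn.
pose T := @sym_tensor K n e.+2 f.
have [Ts _ _] := @sym_tensorP K n e.+2 f hf.
(* Freezing the first column fixes [B]; only the columns [o1] and [o2] enter the remaining tests. *)
pose J : pred ('I_n * 'I_n) := fun p => p.2 == o0.
apply: (card_splice (J := J)) => x0.
pose B := hess T (fun i => v (x0 (i, o0))).
pose Y w := invmx B *m hess T w.
pose col k (y : 'I_n * 'I_n -> K) i := y (i, k).
have accept x : algorithm e.+2 hn f (\matrix_(i, j) v (splice J x0 x (i, j))) ->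
    [/\ B \in unitmx, comm_mx (Y (col o1 (v \o x))) (Y (col o2 (v \o x))) &
        diagonalizable (Y (col o1 (v \o x)))].
  have colE k : hess T (fun i => (\matrix_(i, j) v (splice J x0 x (i, j))) i k) =
      if k == o0 then B else hess T (col k (v \o x)).
    have [->|ko] := eqVneq k o0; apply: eq_hess => i; rewrite mxE ffunE /J /=.
      by rewrite ?eqxx.
    by rewrite (negbTE ko).
  rewrite algorithmE // !colE eqxx /= => /and4P[_ Bu /eqP c /asboolP d].
  by split.
have [Bu|Bu] := boolP (B \in unitmx); last first.
  suff -> : #|[pred x | [pred x : {ffun 'I_n * 'I_n -> S} |
      algorithm e.+2 hn f (\matrix_(i, j) v (x (i, j)))] (splice J x0 x)]| = 0%N.
    by rewrite muln0.
  apply: eq_card0 => x; rewrite !inE; apply/negbTE; apply: contra Bu.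
  by case/accept.
have polyY k a b : polyfun e (fun y : 'I_n * 'I_n -> K => Y (col k y) a b).
  rewrite -[e]add0n; apply: polyfun_mulmx => i j; first exact: polyfun_const.
  exact: polyfun_hess.
(* It is enough to find a polynomial of degree at most [2 * e], nonzero somewhere, that vanishes on
   every accepting run. *)
have sub q (F : ('I_n * 'I_n -> K) -> K) y : (q <= 2 * e)%N -> polyfun q F ->
    F y != 0 ->
    (forall x : {ffun 'I_n * 'I_n -> S},
       algorithm e.+2 hn f (\matrix_(i, j) v (splice J x0 x (i, j))) ->
       F (v \o x) = 0) ->
    (#|S| * #|[pred x | [pred x : {ffun 'I_n * 'I_n -> S} |
      algorithm e.+2 hn f (\matrix_(i, j) v (x (i, j)))] (splice J x0 x)]| <=
     (2 * e) * #|{ffun 'I_n * 'I_n -> S}|)%N.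
  move=> qe Fq Fy hF; apply: leq_trans (leq_mul qe (leqnn _)).
  apply: leq_trans (schwartz_zippel vI Fq Fy).
  rewrite leq_mul2l subset_leq_card ?orbT //; apply/subsetP => x.
  by rewrite !inE => /hF ->.
have [cY|/existsNP[w1 /existsNP[w2 /eqP]]] :=
  pselect (forall w1 w2, Y w1 *m Y w2 = Y w2 *m Y w1); last first.
  rewrite -subr_eq0 => /eqP/matrixP/existsNP[a /existsNP[b /eqP ab]].
  rewrite [X in _ != X]mxE in ab.
  pose F (y : 'I_n * 'I_n -> K) :=
    (Y (col o1 y) *m Y (col o2 y)) a b - (Y (col o2 y) *m Y (col o1 y)) a b.
  apply: (sub (e + e)%N F (fun p => if p.2 == o1 then w1 p.1 else w2 p.1)).
  - by rewrite mul2n addnn.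
  - rewrite /F; apply: polyfunD; first exact: polyfun_mulmx.
    apply: (@eq_polyfun _ _ _
      (fun y => -1 * (Y (col o2 y) *m Y (col o1 y)) a b)) => [y|].
      exact: mulN1r.
    by apply: polyfunZ; exact: polyfun_mulmx.
  - by move: ab; rewrite mxE [X in _ + X]mxE.
  - by move=> x /accept[_ c _]; rewrite /F c subrr.
have [s sZ sspan] := finite_span Y (fun w => diagonalizable (Y w)).
have [allY|/existsNP[w /negP ws]] := pselect (forall w, Y w \in <<s>>%VS).
  (* One congruence diagonalises [B *m A] for the finitely many [A] in [s]; by linearity it
     diagonalises every [hess T w], which contradicts the assumption on [f]. *)
  case: fP; have BY w : B *m Y w = hess T w by rewrite mulKVmx.
  have [A /sZ[w _ ->]|A A' /sZ[w _ ->] /sZ[w' _ ->]|A /sZ[w ? ->] //|C Cu Cd] :=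
    simult_congr_diag Bu (hess_sym _ Ts) (As := s).
  - by rewrite BY hess_sym.
  - exact: cY.
  apply: (@diag_hess_equivalent _ _ _ _ C^T (fun i => v (x0 (i, o0)))) => //.
    by rewrite unitmx_tr.
  move=> w; rewrite trmxK -/T -BY; move: (allY w).
  apply: (span_closed (P := fun A => is_diag_mx (C *m (B *m A) *m C^T))) => //.
    by rewrite mulmx0 mulmx0 mul0mx mx0_is_diag.
  move=> k A A' /is_diag_mxP hA /is_diag_mxP hA'; apply/is_diag_mxP => a b ab.
  rewrite !(mulmxDr, mulmxDl) -!(scalemxAr, scalemxAl).
  by rewrite 2!mxE hA // hA' // mulr0 addr0.
have [L L0 Lw] := separating_endo ws.
have [a [b ab]] : exists a b, L (Y w) a b != 0.
  apply: contrapT => h; move/eqP: Lw; apply; apply/matrixP => a b.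
  by rewrite [RHS]mxE; apply/eqP/negPn/negP => ab; apply: h; exists a, b.
apply: (sub e (fun y => L (Y (col o1 y)) a b) (fun p => w p.1)).
- by rewrite mul2n -addnn leq_addr.
- exact: polyfun_linear.
- exact: ab.
- by move=> x /accept[_ _ d]; rewrite L0 ?mxE //; apply: sspan.
Qed.

(** * Rejection bound for polynomials equivalent to a member of P_d *)

Definition diag_tensor (K : fieldType) (n d : nat) (a : 'I_n -> K) :
    tensor K n d.+1 :=
  fun t => if [forall p, tnth t p == tnth t ord0] then a (tnth t ord0) else 0.

Lemma diag_tensor_const_supported (K : fieldType) (n d : nat)
    (a : 'I_n -> K) : const_supported (@diag_tensor K n d a).
Proof.
move=> t p q; rewrite /diag_tensor; case: forallP => // h.
by rewrite (eqP (h p)) (eqP (h q)) eqxx.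
Qed.

Lemma diag_tensor_nseq (K : fieldType) (n d : nat) (a : 'I_n -> K) (k : 'I_n) :
  @diag_tensor K n d a [tuple of nseq d.+1 k] = a k.
Proof.
rewrite /diag_tensor; case: forallP => [_|[]]; first by rewrite tnth_nseq_const.
by move=> p; rewrite !tnth_nseq_const.
Qed.

Lemma diag_tensor_sym (K : fieldType) (n d : nat) (a : 'I_n -> K) :
  symmetric_tensor (@diag_tensor K n d a).
Proof.
move=> s t.
have [/forallP h|] := boolP [forall p, tnth t p == tnth t ord0].
  have tE : t = [tuple of nseq d.+1 (tnth t ord0)].
    by apply: eq_from_tnth => p; rewrite tnth_nseq_const (eqP (h p)).
  rewrite {1 2}tE; congr (diag_tensor _ _); apply: eq_from_tnth => p.
  by rewrite tnth_mktuple !tnth_nseq_const.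
rewrite negb_forall => /existsP[p tp].
rewrite (diag_tensor_const_supported _ tp).
apply: (@diag_tensor_const_supported _ _ _ _ _ (s^-1%g p) (s^-1%g ord0)).
by rewrite !tnth_mktuple !permKV.
Qed.

Lemma sym_tensor_Pd (K : numFieldType) (n d : nat) (a : 'I_n -> K)
    (g := \sum_(i < n) a i *: 'X_i ^+ d.+1 : {mpoly K[n]}) :
  g \is d.+1.-homog /\ @sym_tensor K n d.+1 g = diag_tensor a.
Proof.
have gE : tensor_poly (@diag_tensor K n d a) = g.
  rewrite tensor_poly_const_supported; last exact: diag_tensor_const_supported.
  by apply: eq_bigr => k _; rewrite diag_tensor_nseq.
have gh : g \is d.+1.-homog by rewrite -gE tensor_poly_homog.
split=> //; have [_ _ uniq] := @sym_tensorP K n d.+1 g gh.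
by rewrite -(uniq _ (@diag_tensor_sym K n d a) gE).
Qed.

(** For a sum of powers every [hess] is diagonal, so the tests on quotients hold. The condition on
    the first column of [N] makes the matrix to be inverted nonsingular. *)
Lemma algorithm_accepts_Pd (K : numFieldType) (n e : nat) (hn : (2 < n)%N)
    (g : {mpoly K[n]}) (N : 'M[K]_n) (o0 := Ordinal (ltnW (ltnW hn))) :
  in_Pd e.+2 g -> N \in unitmx -> (forall k, N k o0 ^+ e != 0) ->
  algorithm e.+2 hn g N.
Proof.
move=> [a a0 ->] Nu N0; have [gh gT] := sym_tensor_Pd e.+1 a.
rewrite algorithmE // Nu /= !gT.
rewrite !hess_const_supported; do ?exact: diag_tensor_const_supported.
set D0 := \row_k _; set D1 := \row_k _; set D2 := \row_k _.
have D0n k : D0 0 k != 0 by rewrite mxE diag_tensor_nseq mulf_neq0 ?N0.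
pose I0 : 'rV[K]_n := \row_k (D0 0 k)^-1.
have D0u : diag_mx D0 \in unitmx.
  by rewrite unitmxE unitfE det_diag; apply/prodf_neq0 => k _.
have DI : diag_mx D0 *m diag_mx I0 = 1%:M.
  rewrite mulmx_diag -diag_const_mx; congr diag_mx; apply/rowP => k.
  by rewrite [LHS]mxE [I0 0 k]mxE [RHS]mxE divff.
have -> : invmx (diag_mx D0) = diag_mx I0.
  by rewrite -[RHS](mulKmx D0u) DI mulmx1.
rewrite D0u !mulmx_diag /=; apply/andP; split.
  by apply/eqP; exact: diag_mx_comm.
apply/asboolP; exact: diagonalizable_diag.
Qed.

Lemma card_algorithm_reject (K : numFieldType) (n e : nat) (hn : (2 < n)%N)
    (S : finType) (v : S -> K) (f : {mpoly K[n]}) :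
  injective v ->
  (exists2 g : {mpoly K[n]}, in_Pd e.+2 g & equivalent f g) ->
  (#|S| * #|[pred x : {ffun 'I_n * 'I_n -> S} |
             ~~ algorithm e.+2 hn f (\matrix_(i, j) v (x (i, j)))]|
     <= (n * e.+1) * #|{ffun 'I_n * 'I_n -> S}|)%N.
Proof.
move=> vI [g gP [A Au ->]].
set o0 := Ordinal (ltnW (ltnW hn)).
pose mx (y : 'I_n * 'I_n -> K) : 'M[K]_n := \matrix_(i, j) y (i, j).
pose F y := \det (mx y) * \prod_(k < n) (A *m mx y) k o0 ^+ e.
have Fpoly : polyfun (n * e.+1) F.
  rewrite mulnS; apply: polyfunM; first exact: polyfun_det.
  apply: (@polyfunW _ _ (\sum_(k < n) e)%N).
    by rewrite sum_nat_const card_ord.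
  apply: polyfun_prod => k.
  apply: (@eq_polyfun _ _ _ (fun y => \prod_(l < e) (A *m mx y) k o0)) => [y|].
    by rewrite prodr_const card_ord.
  apply: (@polyfunW _ _ (\sum_(l < e) 1)%N); first by rewrite sum1_card card_ord.
  apply: polyfun_prod => _; rewrite -[1%N]add0n.
  apply: polyfun_mulmx => i j; first exact: polyfun_const.
  by apply: eq_polyfun (polyfun_coord K (i, j)) => y; rewrite mxE.
(* [L] is unitriangular with first column all ones, so [F] is nonzero at the point
   [invmx A *m L]. *)
pose L : 'M[K]_n := \matrix_(i, j) ((i == j) || (j == o0))%:R.
have Lu : L \in unitmx.
  rewrite unitmxE det_trig; last first.
    apply/is_trig_mxP => i j ij; rewrite mxE -!val_eqE /= ltn_eqF //=.
    by rewrite gtn_eqF // (leq_ltn_trans _ ij).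
  by rewrite big1 ?unitr1 // => i _; rewrite mxE eqxx.
pose y0 (p : 'I_n * 'I_n) := (invmx A *m L) p.1 p.2.
have mxy0 : mx y0 = invmx A *m L by apply/matrixP => i j; rewrite mxE.
have Fy0 : F y0 != 0.
  rewrite /F mxy0 mulKVmx // mulf_neq0 //.
    by rewrite -unitfE -unitmxE unitmx_mul unitmx_inv Au.
  by apply/prodf_neq0 => k _; rewrite mxE eqxx orbT expr1n oner_neq0.
apply: leq_trans (schwartz_zippel vI Fpoly Fy0).
rewrite leq_mul2l subset_leq_card ?orbT //; apply/subsetP => x.
rewrite !inE; apply: contraR; rewrite mulf_eq0 => /norP[dx /prodf_neq0 px].
rewrite /algorithm lin_substM; apply: algorithm_accepts_Pd => //.
  by rewrite unitmx_mul Au unitmxE unitfE.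
by move=> k; apply: px.
Qed.

Theorem theorem3p1 (R : realType) (K : numFieldType)
    (hK : real_or_complex R K) (n d : nat) (hn : (3 <= n)%N) (hd : (2 <= d)%N)
    (S : {fset K}) (hS : S != fset0) (f : {mpoly K[n]})
    (hf : f \is d.-homog) :
  (~ (exists2 g : {mpoly K[n]}, in_Pd d g & equivalent f g) ->
     1 - (2 * (d - 2))%:R / #|` S|%:R
       <= prob_uniform_mx R S (fun M => ~~ algorithm d hn f M))
  /\
  ((exists2 g : {mpoly K[n]}, in_Pd d g & equivalent f g) ->
     1 - (n * (d - 1))%:R / #|` S|%:R
       <= prob_uniform_mx R S (fun M => algorithm d hn f M)).
Proof.
case: d hd hf => [|[|e]] // _ hf; rewrite subn2 subn1 /=; split=> fP.
  apply: prob_uniform_mx_ge => //.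
  by apply: card_algorithm_accept fP => //; exact: val_inj.
have -> : prob_uniform_mx R S (fun M => algorithm e.+2 hn f M) =
    prob_uniform_mx R S (fun M => ~~ ~~ algorithm e.+2 hn f M).
  by apply: eq_bigl => M; rewrite negbK.
apply: prob_uniform_mx_ge => //.
by apply: card_algorithm_reject fP; exact: val_inj.
Qed.
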